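(* If $\mathcal{M}$ is a 5-orbit map whose truncation $\mathrm{Tr}(\mathcal{M})$ is a 5-orbit map, then $\mathcal{M}$ is of type $5_{B_p}$ and $\mathrm{Tr}(\mathcal{M})$ is of type $5_{B_d}$.
   Context: A map $\mathcal{M}$ is a 2-cell embedding of a connected graph on a surface. Its flags are the triangles of the barycentric subdivision of $\mathcal{M}$, each identified with a triple $(\Phi_0,\Phi_1,\Phi_2)$ of a mutually incident vertex, edge and face; $\mathcal{F}(\mathcal{M})$ is the set of flags. For $i\in\{0,1,2\}$ let $s_i$ be the permutation of $\mathcal{F}(\mathcal{M})$ (acting on the right) sending each flag $\Phi$ to its $i$-adjacent flag $\Phi^{s_i}=\Phi^i$ (the neighbouring triangle differing from $\Phi$ only in the entry $\Phi_i$). The $s_i$ are fixed-point free involutions, $s_0s_2=s_2s_0$ is a fixed-point free involution, and $\langle s_0,s_1,s_2\rangle$ is transitive on $\mathcal{F}(\mathcal{M})$. The automorphism group $\Gamma(\mathcal{M})$ is (identified with) the group of permutations of $\mathcal{F}(\mathcal{M})$ commuting with $s_0,s_1,s_2$; it acts freely on flags. $\mathcal{M}$ is a $k$-orbit map if $\Gamma(\mathcal{M})$ has exactly $k$ orbits on $\mathcal{F}(\mathcal{M})$. The $s_i$ act on the set $\mathrm{Orb}(\mathcal{M})$ of flag-orbits by $\mathcal{O}_\Phi\cdot s_i=\mathcal{O}_{\Phi^{s_i}}$. Symmetry type graph: $T(\mathcal{M})$ has vertex set $\mathrm{Orb}(\mathcal{M})$, with an edge of colour $i$ joining two distinct orbits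 interchanged by $s_i$, and a semi-edge of colour $i$ at each orbit fixed by $s_i$. A type with $k$ vertices is given below by a triple $(\sigma_0,\sigma_1,\sigma_2)$ of permutations of $\{1,\dots,k\}$ in cycle notation: $\mathcal{M}$ is of that type iff there is a bijection $\mathrm{Orb}(\mathcal{M})\to\{1,\dots,k\}$ carrying the action of $s_i$ to $\sigma_i$ for $i=0,1,2$. (For $\mathrm{Tr}(\mathcal{M})$, the involutions $r_i$ below play the role of $s_i$.) Truncation: $\mathrm{Tr}(\mathcal{M})$ is the map on the same surface with flag set $\mathcal{F}(\mathcal{M})\times\{0,1,2\}$ and flag adjacencies $r_0,r_1,r_2$ given by $(\Phi,0)r_0=(\Phi^{s_1},0)$, $(\Phi,0)r_1=(\Phi^{s_2},0)$, $(\Phi,0)r_2=(\Phi,2)$; $(\Phi,1)r_0=(\Phi^{s_0},1)$, $(\Phi,1)r_1=(\Phi,2)$, $(\Phi,1)r_2=(\Phi^{s_2},1)$; $(\Phi,2)r_0=(\Phi^{s_1},2)$, $(\Phi,2)r_1=(\Phi,1)$, $(\Phi,2)r_2=(\Phi,0)$. Types on $\{1,2,3,4,5\}$: $5_{B_d}$: $\sigma_0=(1\,4)(2\,3)$, $\sigma_1=(1\,2)(4\,5)$, $\sigma_2=(1\,2)(3\,4)$. $5_{B_p}$: $\sigma_0=(1\,5)(2\,4)$, $\sigma_1=(1\,4)(2\,3)$, $\sigma_2=(1\,2)(4\,5)$. *)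

(* Defs.v *)
From mathcomp Require Import all_boot all_fingroup.
From mathcomp Require Import classical_sets functions cardinality.

Set Implicit Arguments.
Unset Strict Implicit.
Unset Printing Implicit Defensive.

Local Open Scope classical_set_scope.

Definition i0 : 'I_3 := @Ordinal 3 0 isT.
Definition i1 : 'I_3 := @Ordinal 3 1 isT.
Definition i2 : 'I_3 := @Ordinal 3 2 isT.

(* A map on a surface, given by its flags and its flag adjacencies: [adj i] is
   the involution s_i.  The flag set need not be finite.  Since the s_i are
   involutions, transitivity of <s_0, s_1, s_2> is stated with words in the
   s_i, applied from left to right. *)
Record surface_map := SurfaceMap {
  flag : Type;
  adj : 'I_3 -> flag -> flag;
  flag_inhabited : inhabited flag;
  adj_invol : forall i, involutive (adj i);
  adj_free : forall i x, adj i x <> x;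
  adj02_comm : forall x, adj i0 (adj i2 x) = adj i2 (adj i0 x);
  adj02_free : forall x, adj i0 (adj i2 x) <> x;
  adj_trans : forall x y,
    exists w : seq 'I_3, foldl (fun z i => adj i z) x w = y
}.

Definition automorphisms (M : surface_map) : set (flag M -> flag M) :=
  [set a | bijective a /\ forall i x, a (adj i x) = adj i (a x)].
Arguments automorphisms : clear implicits.

Definition flag_orbit (M : surface_map) (x : flag M) : set (flag M) :=
  [set a x | a in automorphisms M].

Definition Orb (M : surface_map) : set (set (flag M)) :=
  range (@flag_orbit M).
Arguments Orb : clear implicits.

Definition is_korbit (k : nat) (M : surface_map) : Prop := (Orb M #= `I_k)%card.

(* The action on Orb M is O_x . s_i = O_(x s_i). *)
Definition has_type (k : nat) (sigma : 3.-tuple 'S_k) (M : surface_map) : Prop :=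
  exists f : set (flag M) -> 'I_k,
    set_bij (Orb M) [set: 'I_k] f /\
    forall i x, f (flag_orbit (adj i x)) = tnth sigma i (f (flag_orbit x)).

(* The transposition (a b) of {1, ..., 5}, with j represented by the element
   of 'I_5 of value j - 1. *)
Definition transp5 (a b : nat) : 'S_5 := tperm (inord a.-1) (inord b.-1).

Definition type5Bd : 3.-tuple 'S_5 :=
  [tuple (transp5 1 4 * transp5 2 3)%g;
         (transp5 1 2 * transp5 4 5)%g;
         (transp5 1 2 * transp5 3 4)%g].

Definition type5Bp : 3.-tuple 'S_5 :=
  [tuple (transp5 1 5 * transp5 2 4)%g;
         (transp5 1 4 * transp5 2 3)%g;
         (transp5 1 2 * transp5 4 5)%g].

(* [trunc_adj i (x, j)] is (x, j) r_i; the match is on j, then i. *)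
Definition trunc_adj (M : surface_map) (i : 'I_3) (p : flag M * 'I_3) :
    flag M * 'I_3 :=
  let: (x, j) := p in
  match val j, val i with
  | 0, 0 => (adj i1 x, i0)
  | 0, 1 => (adj i2 x, i0)
  | 0, _ => (x, i2)
  | 1, 0 => (adj i0 x, i1)
  | 1, 1 => (x, i2)
  | 1, _ => (adj i2 x, i1)
  | _, 0 => (adj i1 x, i2)
  | _, 1 => (x, i1)
  | _, _ => (x, i0)
  end.

Lemma ord3_cases (P : 'I_3 -> Prop) : P i0 -> P i1 -> P i2 -> forall i, P i.
Proof.
move=> P0 P1 P2 [[|[|[|//]]] lti].
- by rewrite (_ : Ordinal lti = i0) //; apply: val_inj.
- by rewrite (_ : Ordinal lti = i1) //; apply: val_inj.
- by rewrite (_ : Ordinal lti = i2) //; apply: val_inj.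
Qed.

Section Truncation.
Variable M : surface_map.

Lemma trunc_inhabited : inhabited (flag M * 'I_3).
Proof. by case: (flag_inhabited M) => x; exact: (inhabits (x, i0)). Qed.

Lemma trunc_adj_invol i : involutive (@trunc_adj M i).
Proof.
by move=> [x j]; elim/ord3_cases: i; elim/ord3_cases: j; rewrite /= ?adj_invol.
Qed.

Lemma trunc_adj_free i (p : flag M * 'I_3) : trunc_adj i p <> p.
Proof.
by case: p => x j; elim/ord3_cases: i; elim/ord3_cases: j => //= -[];
  exact: adj_free.
Qed.

Lemma trunc_adj02_comm (p : flag M * 'I_3) :
  trunc_adj i0 (trunc_adj i2 p) = trunc_adj i2 (trunc_adj i0 p).
Proof. by case: p => x j; elim/ord3_cases: j; rewrite /= ?adj02_comm. Qed.

Lemma trunc_adj02_free (p : flag M * 'I_3) :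
  trunc_adj i0 (trunc_adj i2 p) <> p.
Proof.
by case: p => x j; elim/ord3_cases: j => //= -[]; exact: adj02_free.
Qed.

Lemma trunc_adj_trans (p q : flag M * 'I_3) :
  exists w : seq 'I_3, foldl (fun z i => trunc_adj i z) p w = q.
Proof.
pose go p q := exists w : seq 'I_3, foldl (fun z i => @trunc_adj M i z) p w = q.
have goT a b c : go a b -> go b c -> go a c.
  by move=> [u <-] [v <-]; exists (u ++ v); rewrite foldl_cat.
case: p q => [x j] [y k].
have to0 : go (x, j) (x, i0).
  elim/ord3_cases: j; first by exists [::].
    by exists [:: i1; i2].
  by exists [:: i2].
have from0 : go (y, i0) (y, k).
  elim/ord3_cases: k; first by exists [::].
    by exists [:: i2; i1].
  by exists [:: i2].
apply: (goT _ _ _ to0 (goT _ _ _ _ from0)).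
have [w <-] := adj_trans x y; elim: w x {j to0 from0} => [|i w IHw] x /=.
  by exists [::].
apply: (goT _ _ _ _ (IHw _)); elim/ord3_cases: i.
- by exists [:: i2; i1; i0; i1; i2].
- by exists [:: i0].
- by exists [:: i1].
Qed.

Definition truncation : surface_map :=
  SurfaceMap trunc_inhabited trunc_adj_invol trunc_adj_free trunc_adj02_comm
    trunc_adj02_free trunc_adj_trans.

End Truncation.

(* Main.v *)
Require Import Defs.
From mathcomp Require Import all_boot all_fingroup.
From mathcomp Require Import boolp classical_sets functions cardinality.

Set Implicit Arguments.
Unset Strict Implicit.
Unset Printing Implicit Defensive.

(** In Tr(M) every vertex has degree 3, so its adjacencies satisfy
    (r_1 r_2)^3 = 1, that is r_1 r_2 r_1 = r_2 r_1 r_2.  The flag adjacencies of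
    a 5-orbit map induce a transitive triple of involutions t_0, t_1, t_2 of its
    five flag-orbits, with t_0 t_2 = t_2 t_0; up to relabelling, a unique such
    triple also satisfies t_1 t_2 t_1 = t_2 t_1 t_2 ([transitive_braid5]).  It
    is the one of 5_Bd, so every 5-orbit map satisfying the braid relation, and
    Tr(M) in particular, has type 5_Bd ([type5Bd_of_braid]).

    It remains to read off the type of M.  An automorphism of Tr(M) that sends
    one flag (x, j) to a flag (y, j) of the same level preserves every level,
    hence comes from an automorphism of M ([level_orbits]).  So sending the
    orbit of x to the orbit of (x, 0) is an injection from the orbits of M to
    those of Tr(M), and a bijection because both sets have five elements
    ([level_labelling]).  Under this bijection s_1 and s_2 act as r_0 and r_1
    do, while s_0, visible only on level 1, acts as the conjugate
    r_2 r_1 r_0 r_1 r_2: this turns the triple of 5_Bd into the triple of 5_Bp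
    ([type5Bp_of_type5Bd]). *)

(** * Transitive triples of involutions on five points *)

(** A point fixed by t2 but not by t1 is the end of a path whose other end is
    fixed by t1: conjugation by t1 t2 turns the reflection t2 into t1. *)
Lemma path_of_fixed (T : eqType) (t1 t2 : T -> T) :
  involutive t1 -> involutive t2 ->
  (forall x, t1 (t2 (t1 x)) = t2 (t1 (t2 x))) ->
  forall p, t2 p = p -> t1 p != p ->
  uniq [:: p; t1 p; t2 (t1 p)] /\ t1 (t2 (t1 p)) = t2 (t1 p).
Proof.
move=> t1K t2K braid p t2p t1p.
have t1r : t1 (t2 (t1 p)) = t2 (t1 p) by rewrite braid t2p.
split=> //; rewrite /= !inE negb_or andbT (eq_sym p) t1p /=.
apply/andP; split; apply: contraNneq t1p => E.
  by rewrite -(can_inj t2K (etrans t2p E)).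
by rewrite -{2}[p]t1K E t1r.
Qed.

(** The braid relation makes t1 and t2 generate a quotient of S_3, whose six
    elements move x to six points unless a reflection fixes a point of its
    orbit.  All reflections are conjugate, so t2 then has fixed points in this
    orbit; if t1 fixed them too, t1 and t2 would coincide on the orbit. *)
Lemma exists_path (T : finType) (t1 t2 : T -> T) :
  #|T| < 6 -> involutive t1 -> involutive t2 ->
  (forall x, t1 (t2 (t1 x)) = t2 (t1 (t2 x))) ->
  forall x, t1 x != t2 x -> exists p, t2 p = p /\ t1 p != p.
Proof.
move=> cardT t1K t2K braid x /eqP t12x.
have [//|nofix] := pselect (exists p, t2 p = p /\ t1 p != p); exfalso.
have fix1 y : t2 y = y -> t1 y = y.
  by move=> t2y; apply/eqP/negP => /negP t1y; apply: nofix; exists y.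
have fix2 y : t1 y = y -> t2 y = y.
  move=> t1y; have F : t2 (t1 (t2 y)) = t1 (t2 y) by rewrite -braid t1y.
  by have := fix1 _ F; rewrite t1K => E; rewrite -E t2K in F.
have nfix1 : t1 x <> x by move=> E; apply: t12x; rewrite fix2.
have nfix2 : t2 x <> x by move=> E; apply: t12x; rewrite fix1.
have nfix3 : t1 (t2 (t1 x)) <> x.
  by move=> /(canRL t1K) /fix1; rewrite t1K => /esym.
suff /card_uniqP sz6 :
    uniq [:: x; t1 (t2 x); t2 (t1 x); t1 x; t2 x; t1 (t2 (t1 x))].
  have := max_card
    (mem [:: x; t1 (t2 x); t2 (t1 x); t1 x; t2 x; t1 (t2 (t1 x))]).
  by rewrite sz6 leqNgt cardT.
have N12 : x <> t1 (t2 x) by move/esym/(canRL t1K)/esym.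
have N21 : x <> t2 (t1 x) by move/esym/(canRL t2K).
rewrite /= !inE !negb_or -!andbA.
repeat (apply/andP; split); apply/eqP => //; try exact/nesym.
- rewrite -[t2 (t1 x) in X in _ = X]t1K braid.
  by move=> /(can_inj t1K)/(can_inj t2K).
- by move/(can_inj t1K).
- by move/fix2; rewrite t2K => /esym.
- by move/(can_inj t1K)/(can_inj t2K)/esym.
- by move/fix1; rewrite t1K => /esym.
- by move/(can_inj t2K).
- by rewrite braid => /(can_inj t2K)/(can_inj t1K)/esym.
- by move/(can_inj t1K).
- by rewrite braid => /(can_inj t2K).
Qed.

(** If t1 = t2, then t0 and t1 generate a group of order at most 4, too small to
    be transitive; so there is a path p, q, r as in [path_of_fixed].  As t0
    preserves the fixed points of t2, and p is one, t0 must move q out of the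
    path: otherwise it preserves {q, r}, and p, q, r, t0 p form a closed set of
    at most four points.  Hence t0 maps {q, r} to the other two points, and
    commutation with t2 and the braid relation decide the rest. *)
Lemma transitive_braid5 (T : finType) (t0 t1 t2 : T -> T) :
  #|T| = 5 -> involutive t0 -> involutive t1 -> involutive t2 ->
  (forall x, t0 (t2 x) = t2 (t0 x)) ->
  (forall x, t1 (t2 (t1 x)) = t2 (t1 (t2 x))) ->
  (forall (s : seq T) x, x \in s ->
     (forall y, y \in s -> [&& t0 y \in s, t1 y \in s & t2 y \in s]) ->
     forall y, y \in s) ->
  exists p q r d e : T, [/\ uniq [:: p; q; r; d; e],
    [/\ t0 p = p, t0 q = d & t0 r = e],
    [/\ t1 p = q, t1 r = r & t1 d = e] &
    [/\ t2 p = p, t2 q = r & t2 d = e]].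
Proof.
move=> cardT t0K t1K t2K comm braid trans.
have small (s : seq T) x : size s < 5 -> x \in s ->
    ~ (forall y, y \in s -> [&& t0 y \in s, t1 y \in s & t2 y \in s]).
  move=> lts xs /(trans s x xs) sT.
  have := uniq_leq_size (enum_uniq T) (fun y _ => sT y).
  by rewrite -cardE cardT leqNgt lts.
have few (s : seq T) : uniq s -> size s <= 5.
  by move/card_uniqP <-; rewrite -cardT max_card.
(* [exists_path] needs a point where t1 and t2 differ. *)
have [x t12x] : exists x, t1 x != t2 x.
  have [//|eq12] := pselect (exists x, t1 x != t2 x).
  have t21 y : t2 y = t1 y.
    by apply/esym/eqP/negP => /negP N; apply: eq12; exists y.
  have comm1 y : t0 (t1 y) = t1 (t0 y) by rewrite -!t21.
  have : 0 < #|T| by rewrite cardT.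
  case/card_gt0P=> x _.
  case: (small [:: x; t0 x; t1 x; t0 (t1 x)] x) => //.
    by rewrite mem_head.
  by move=> y; rewrite !inE => /or4P[] /eqP->;
    rewrite !t21 -?comm1 ?t0K ?t1K ?comm1 ?t1K -?comm1 !eqxx ?orbT.
have [|p [t2p t1p]] := exists_path _ t1K t2K braid t12x; first by rewrite cardT.
have [pqr t1r] := path_of_fixed t1K t2K braid t2p t1p.
set q := t1 p in pqr t1r t1p; set r := t2 q in pqr t1r.
have t1q : t1 q = p by rewrite /q t1K.
have t2r : t2 r = q by rewrite /r t2K.
have [neq_pq neq_pr neq_qr] : [/\ p != q, p != r & q != r].
  by move: pqr; rewrite /= !inE negb_or andbT => /andP[/andP[-> ->] ->].
have t0p : t2 (t0 p) = t0 p by rewrite -comm t2p.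
have t2t0q : t2 (t0 q) = t0 r by rewrite -comm.
have t2t0r : t2 (t0 r) = t0 q by rewrite -comm t2r.
have cl y : y \in [:: p; q; r] ->
   (t1 y \in [:: p; q; r]) && (t2 y \in [:: p; q; r]).
  by rewrite !inE => /or3P[] /eqP->;
    rewrite ?t1q ?t1r ?t2p -?/q -?/r ?t2r !eqxx ?orbT.
have dNpqr : t0 q \notin [:: p; q; r].
  apply/negP => dpqr.
  have dp : t0 q != p.
    apply: contraNneq neq_qr => E.
    by apply/eqP/(can_inj t0K); rewrite -t2t0q E t2p.
  have t0qr : (t0 q \in [:: q; r]) && (t0 r \in [:: q; r]).
    move: dpqr; rewrite -t2t0q !inE (negPf dp) /=.
    by case/orP=> /eqP->; rewrite -?/r ?t2r ?eqxx ?orbT.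
  have [upqr|uNpqr] := boolP (t0 p \in [:: p; q; r]).
    case: (small [:: p; q; r] p) => //; first exact: mem_head.
    move=> y ys; rewrite (cl y ys) !andbT.
    move: ys t0qr; rewrite !inE => /or3P[] /eqP-> /andP[a b].
    - by rewrite !inE in upqr.
    - by rewrite a orbT.
    - by rewrite b orbT.
  (* t0 p is a fixed point of t2; if t1 moves it, it starts a second path,
     disjoint from the first, and there are not six points. *)
  have sub z : z \in [:: p; q; r] -> z \in [:: t0 p; p; q; r].
    by move=> zs; rewrite inE zs orbT.
  have [t1u|t1u] := eqVneq (t1 (t0 p)) (t0 p).
    case: (small [:: t0 p; p; q; r] p) => //; first by rewrite !inE eqxx orbT.
    move=> y; rewrite inE => /predU1P[->|ys].
      by rewrite t0K t1u t0p !inE !eqxx ?orbT.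
    have /andP[/sub a /sub b] := cl y ys; rewrite a b !andbT.
    move: ys t0qr; rewrite !inE => /or3P[] /eqP->; rewrite ?eqxx // => /andP[].
      by move=> /orP[]->; rewrite ?orbT.
    by move=> _ /orP[]->; rewrite ?orbT.
  have [u3 t1w] := path_of_fixed t1K t2K braid t0p t1u.
  have disj z : z \in [:: t0 p; t1 (t0 p); t2 (t1 (t0 p))] ->
      z \notin [:: p; q; r].
    have cl' y : t1 y \in [:: p; q; r] -> y \in [:: p; q; r].
      by move/cl; rewrite t1K => /andP[].
    have cl'' y : t2 y \in [:: p; q; r] -> y \in [:: p; q; r].
      by move/cl; rewrite t2K => /andP[].
    rewrite 3!inE.
    case/or3P=> /eqP-> //; apply: contraNN uNpqr; first exact: cl'.
    by move/cl''/cl'.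
  have : uniq ([:: p; q; r] ++ [:: t0 p; t1 (t0 p); t2 (t1 (t0 p))]).
    by rewrite cat_uniq pqr u3 andbT -all_predC; apply/allP => z /disj.
  by move/few.
have eNpqr : t0 r \notin [:: p; q; r].
  rewrite -t2t0q; apply: contraNN dNpqr => /cl /andP[_].
  by rewrite t2K.
have pqrde : uniq [:: p; q; r; t0 q; t0 r].
  rewrite -[[:: p; q; r; _; _]]/([:: p; q; r] ++ [:: t0 q; t0 r]) cat_uniq pqr.
  rewrite cons_uniq !inE (can_eq t0K) neq_qr !andbT.
  by apply/(@hasPn T) => z; rewrite (mem_seq2 z) => /orP[] /eqP->.
have all5 z : z \in [:: p; q; r; t0 q; t0 r].
  have [//|zN] := boolP (z \in _).
  have : uniq [:: z; p; q; r; t0 q; t0 r] by rewrite cons_uniq zN.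
  by move/few.
have neq_de : t0 q != t0 r by rewrite (can_eq t0K).
have cl' y : y \notin [:: p; q; r] -> t1 y \in [:: t0 q; t0 r].
  move=> yN; have := all5 (t1 y).
  rewrite -[[:: p; q; r; _; _]]/([:: p; q; r] ++ [:: t0 q; t0 r]) mem_cat.
  by case/orP=> // /cl; rewrite t1K (negPf yN).
exists p, q, r, (t0 q), (t0 r); split=> //; split=> //.
- have := all5 (t0 p); rewrite !inE !(can_eq t0K).
  rewrite (negPf neq_pq) (negPf neq_pr) !orbF.
  case/or3P=> /eqP // E; move: t0p; rewrite E -?/r ?t2r => /eqP.
    by rewrite eq_sym (negPf neq_qr).
  by rewrite (negPf neq_qr).
- have := cl' _ dNpqr; rewrite !inE => /orP[] /eqP // t1d.
  have := cl' _ eNpqr; rewrite !inE => /orP[] /eqP t1e.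
    by move: neq_de; rewrite -(can_eq t1K) t1d t1e eqxx.
  by have := braid (t0 q); rewrite t1d t2t0q t1e t2t0r => ->.
Qed.

(** * Flag-orbits and their labellings *)

Section Automorphisms.
Variable M : surface_map.

Lemma automorphisms_id : automorphisms M id.
Proof. by split=> //; exists id. Qed.

Lemma automorphisms_comp a b :
  automorphisms M a -> automorphisms M b -> automorphisms M (a \o b).
Proof.
move=> [abij aC] [bbij bC]; split; first exact: bij_comp.
by move=> i x /=; rewrite bC aC.
Qed.

Lemma automorphisms_inv a : automorphisms M a ->
  exists2 b, automorphisms M b & cancel a b /\ cancel b a.
Proof.
move=> [[b aK bK] aC]; exists b => //; split; first by exists a.
by move=> i x; apply: (can_inj aK); rewrite aC !bK.
Qed.

Lemma flag_orbitP (x y : flag M) :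
  flag_orbit x = flag_orbit y <-> exists2 a, automorphisms M a & a x = y.
Proof.
split=> [xy|[a aA <-]].
  have : flag_orbit y y by exists id => //; exact: automorphisms_id.
  by rewrite -xy.
rewrite predeqE => z; split=> -[b bA <-].
  have [c cA [aK cK]] := automorphisms_inv aA.
  by exists (b \o c) => /=; [exact: automorphisms_comp | rewrite aK].
by exists (b \o a) => //; exact: automorphisms_comp.
Qed.

Lemma flag_orbit_adj i (x y : flag M) :
  flag_orbit x = flag_orbit y -> flag_orbit (adj i x) = flag_orbit (adj i y).
Proof.
move=> /flag_orbitP[a [abij aC] <-]; apply/flag_orbitP.
by exists a; rewrite ?aC.
Qed.

End Automorphisms.

(** A bijection between [Orb M] and ['I_k], presented as a function on flags:
    this avoids choosing representatives of orbits. *)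
Definition orbit_labelling (M : surface_map) (k : nat) (c : flag M -> 'I_k) :=
  (forall v, exists x, c x = v) /\
  (forall x y, c x = c y <-> flag_orbit x = flag_orbit y).

Lemma korbit_labelling (M : surface_map) (k : nat) :
  is_korbit k.+1 M -> exists c : flag M -> 'I_k.+1, orbit_labelling c.
Proof.
move=> /card_set_bijP[f [fsub finj fsurj]].
have flt x : f (flag_orbit x) < k.+1 by apply: fsub; exists x.
exists (fun x => inord (f (flag_orbit x))); split=> [v|x y].
  have [|_ [x _ <-] fx] := fsurj v; first exact: ltn_ord.
  by exists x; rewrite fx inord_val.
split=> [/(congr1 val)|->] //; rewrite /= !inordK // => fxy.
by apply: finj => //; rewrite inE; [exists x | exists y].
Qed.

Lemma labelling_has_type (M : surface_map) (k : nat) (sigma : 3.-tuple 'S_k)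
    (c : flag M -> 'I_k) :
  orbit_labelling c -> (forall i x, c (adj i x) = tnth sigma i (c x)) ->
  has_type sigma M.
Proof.
move=> [csurj cP] cadj.
have /choice[f fP] : forall A : set (flag M), exists v,
    forall x, A = flag_orbit x -> v = c x.
  move=> A; have [[x ->]|Nx] := pselect (exists x, A = flag_orbit x).
    by exists (c x) => y /cP.
  have [x0] := flag_inhabited M.
  by exists (c x0) => x Ax; case: Nx; exists x.
have fE x : f (flag_orbit x) = c x by exact: fP.
exists f; split; last by move=> i x; rewrite !fE.
split=> // [|v _].
  by move=> _ _ /set_mem[x _ <-] /set_mem[y _ <-]; rewrite !fE => /cP.
have [x <-] := csurj v; exists (flag_orbit x); last exact: fE.
by exists x.
Qed.

(** Automorphisms commute with the adjacencies, so these act on labels. *)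
Lemma labelling_action (M : surface_map) (k : nat) (c : flag M -> 'I_k) :
  orbit_labelling c ->
  exists t : 'I_3 -> 'I_k -> 'I_k, forall i x, c (adj i x) = t i (c x).
Proof.
move=> [csurj cP].
have /choice[t tP] : forall iv : 'I_3 * 'I_k, exists w,
    forall x, c x = iv.2 -> c (adj iv.1 x) = w.
  move=> [i v]; have [x xv] := csurj v; exists (c (adj i x)) => y /= yv.
  by apply/cP/flag_orbit_adj/cP; rewrite xv.
by exists (fun i v => t (i, v)) => i x; exact: (tP (i, c x)).
Qed.

Lemma relabelling (M : surface_map) (k : nat) (c : flag M -> 'I_k)
    (h : 'I_k -> 'I_k) :
  orbit_labelling c -> bijective h -> orbit_labelling (h \o c).
Proof.
move=> [csurj cP] [g hK gK]; split=> [v|x y].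
  by have [x xv] := csurj (g v); exists x; rewrite /= xv gK.
by rewrite -cP /=; split=> [/(can_inj hK)|->].
Qed.

(** * Five-orbit maps satisfying the braid relation *)

Lemma transp5E a b (v : 'I_5) : 0 < a <= 5 -> 0 < b <= 5 ->
  transp5 a b v =
    (if v.+1 == a then b.-1 else if v.+1 == b then a.-1 else v) :> nat.
Proof.
case: a b => [|a] [|b] //= lta ltb.
rewrite permE /= -!val_eqE /= !inordK // !eqSS.
by do 2?case: ifP => //; rewrite ?inordK.
Qed.

Lemma ord5_cases (P : 'I_5 -> Prop) :
  P (inord 0) -> P (inord 1) -> P (inord 2) -> P (inord 3) -> P (inord 4) ->
  forall v, P v.
Proof.
move=> P0 P1 P2 P3 P4 v; rewrite -(inord_val v).
by case: v => [[|[|[|[|[|?]]]]]].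
Qed.

Lemma type5BdE i v : tnth type5Bd i v =
  nth 0 (nth [::] [:: [:: 3; 2; 1; 0; 4]; [:: 1; 0; 2; 4; 3];
                      [:: 1; 0; 3; 2; 4]] i) v :> nat.
Proof.
by elim/ord5_cases: v; elim/ord3_cases: i;
  rewrite (tnth_nth 1%g) /= permM !transp5E // !inordK.
Qed.

Lemma type5BpE i v : tnth type5Bp i v =
  nth 0 (nth [::] [:: [:: 4; 3; 2; 1; 0]; [:: 3; 2; 1; 0; 4];
                      [:: 1; 0; 2; 4; 3]] i) v :> nat.
Proof.
by elim/ord5_cases: v; elim/ord3_cases: i;
  rewrite (tnth_nth 1%g) /= permM !transp5E // !inordK.
Qed.

(** The braid relation between s_1 and s_2 says that all vertices have degree
    dividing 3; it passes to the action on orbits, where it determines the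
    type. *)
Lemma type5Bd_of_braid (M : surface_map) :
  is_korbit 5 M -> (forall x : flag M,
    adj i1 (adj i2 (adj i1 x)) = adj i2 (adj i1 (adj i2 x))) ->
  exists c : flag M -> 'I_5, orbit_labelling c /\
    forall i x, c (adj i x) = tnth type5Bd i (c x).
Proof.
move=> /korbit_labelling[c cL] braid.
have [t ct] := labelling_action cL; have [csurj _] := cL.
have tK i : involutive (t i).
  by move=> v; have [x <-] := csurj v; rewrite -!ct adj_invol.
have [||s v0 v0s scl v|p [q [r [d [e
    [pqrde [t0p t0q t0r] [t1p t1r t1d] [t2p t2q t2d]]]]]]] :=
  transitive_braid5 (card_ord 5) (tK i0) (tK i1) (tK i2).
- by move=> v; have [x <-] := csurj v; rewrite -!ct adj02_comm.
- by move=> v; have [x <-] := csurj v; rewrite -!ct braid.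
- have [[x0 cx0] [x <-]] := (csurj v0, csurj v).
  have [w <-] := adj_trans x0 x; rewrite -cx0 in v0s.
  elim: w x0 v0s {cx0} => //= i w IHw x0 /scl/and3P[s0 s1 s2].
  by apply: IHw; rewrite ct; elim/ord3_cases: i.
have t0d : t i0 d = q by rewrite -t0q tK.
have t0e : t i0 e = r by rewrite -t0r tK.
have t1q : t i1 q = p by rewrite -t1p tK.
have t1e : t i1 e = d by rewrite -t1d tK.
have t2r : t i2 r = q by rewrite -t2q tK.
have t2e : t i2 e = d by rewrite -t2d tK.
(* The path p, q, r is 5, 4, 3 in the labels of 5_Bd. *)
pose g v := nth p [:: d; e; r; q; p] (nat_of_ord (v : 'I_5)).
have g_inj : injective g.
  move=> v w /eqP; rewrite nth_uniq ?ltn_ord //; first by move/eqP/val_inj.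
  move: pqrde; rewrite (perm_uniq (s2 := [:: d; e; r; q; p])) //.
  apply/seq.permP => a /=; rewrite !addn0.
  by case: (a p) (a q) (a r) (a d) (a e) => [] [] [] [] [].
have [h gh hg] := injF_bij g_inj.
exists (h \o c); split; first by apply: relabelling => //; exists g.
move=> i x /=; rewrite ct; apply: g_inj; rewrite hg.
rewrite -{1}[c x]hg; move: (h (c x)) => v.
by elim/ord5_cases: v; elim/ord3_cases: i; rewrite /g type5BdE /= !inordK.
Qed.

(** * Orbits of the truncation *)

Section Truncation.
Variable M : surface_map.

Lemma truncation_braid (p : flag (truncation M)) :
  adj i1 (adj i2 (adj i1 p)) = adj i2 (adj i1 (adj i2 p)).
Proof. by case: p => x j; elim/ord3_cases: j. Qed.

Lemma automorphisms_lift a : automorphisms M a ->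
  automorphisms (truncation M) (fun p => (a p.1, p.2)).
Proof.
move=> [[b aK bK] aC]; split.
  by exists (fun p => (b p.1, p.2)) => -[x j] /=; rewrite ?aK ?bK.
by move=> i [x j]; elim/ord3_cases: i; elim/ord3_cases: j; rewrite /= ?aC.
Qed.

Lemma trunc_level (i : 'I_3) (p q : flag (truncation M)) :
  p.2 = q.2 -> (adj i p).2 = (adj i q).2.
Proof.
by case: p q => x j [y k] /= ->; elim/ord3_cases: i; elim/ord3_cases: k.
Qed.

(** The level of an adjacent flag depends only on the level of the flag, so an
    automorphism fixing one level is traced along words to fix them all. *)
Lemma automorphisms_level a (p : flag (truncation M)) :
  automorphisms (truncation M) a -> (a p).2 = p.2 -> forall q, (a q).2 = q.2.
Proof.
move=> [_ aC] pp q; have [w <-] := adj_trans p q.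
elim: w p pp => //= i w IHw p pp; apply: IHw.
by rewrite aC; exact: trunc_level.
Qed.

(** Flags of levels 0 and 2, or 1 and 2, over the same flag x of M are adjacent,
    so a level-preserving automorphism moves the three flags over x alike; each
    s_i is visible on some level, so the induced permutation
    commutes with it. *)
Lemma automorphisms_descend a :
  automorphisms (truncation M) a -> (forall q, (a q).2 = q.2) ->
  exists2 b, automorphisms M b & forall x j, a (x, j) = (b x, j).
Proof.
move=> aA alev; have [a' a'A [aK a'K]] := automorphisms_inv aA.
have a'lev q : (a' q).2 = q.2 by rewrite -alev a'K.
have main f : automorphisms (truncation M) f -> (forall q, (f q).2 = q.2) ->
    forall x j, f (x, j) = ((f (x, i0)).1, j).
  move=> [_ fC] flev x.
  have fE y j : f (y, j) = ((f (y, j)).1, j).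
    by rewrite [LHS]surjective_pairing flev.
  have f02 : f (x, i2) = ((f (x, i0)).1, i2).
    by have := fC i2 (x, i0); rewrite fE => /= ->; rewrite [f (x, i0)]fE.
  elim/ord3_cases=> //; by have := fC i1 (x, i2); rewrite f02.
have [_ aC] := aA.
pose b x := (a (x, i0)).1; pose b' x := (a' (x, i0)).1.
have aE x j : a (x, j) = (b x, j) by exact: main.
have a'E x j : a' (x, j) = (b' x, j) by exact: main.
exists b => //; split.
  exists b' => x; first by have := aK (x, i0); rewrite aE a'E => -[].
  by have := a'K (x, i0); rewrite a'E aE => -[].
elim/ord3_cases=> x.
- by have := aC i0 (x, i1); rewrite /= !aE => -[].
- by have := aC i0 (x, i0); rewrite /= !aE => -[].
- by have := aC i1 (x, i0); rewrite /= !aE => -[].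
Qed.

Lemma level_orbits (x y : flag M) (j : 'I_3) :
  flag_orbit (M := truncation M) (x, j) =
  flag_orbit (M := truncation M) (y, j) <->
  flag_orbit x = flag_orbit y.
Proof.
split=> /flag_orbitP[a aA axy]; apply/flag_orbitP.
  have lev : (a (x, j)).2 = j by rewrite axy.
  have [b bA ab] := automorphisms_descend aA (automorphisms_level aA lev).
  by exists b => //; move: axy; rewrite ab => -[].
by exists (fun p => (a p.1, p.2)); [exact: automorphisms_lift | rewrite /= axy].
Qed.

(** M has as many orbits as its truncation, so the orbits of flags of a single
    level, which correspond to those of M, exhaust the orbits of the
    truncation. *)
Lemma level_labelling (k : nat) (c : flag (truncation M) -> 'I_k.+1)
    (j : 'I_3) :
  is_korbit k.+1 M -> orbit_labelling c ->
  orbit_labelling (fun x : flag M => c (x, j)).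
Proof.
move=> /korbit_labelling[g [gsurj gP]] [_ cP].
have sep x y : c (x, j) = c (y, j) <-> flag_orbit x = flag_orbit y.
  by rewrite cP level_orbits.
split=> // v; have /choice[s sK] := gsurj.
have inj : injective (fun w => c (s w, j)).
  by move=> w w' /sep/gP; rewrite !sK.
by have /codomP[w ->] := injF_onto inj v; exists (s w).
Qed.

End Truncation.

(** The adjacencies of M seen at level 0 of its truncation: s_1 and s_2 are r_0
    and r_1 there, and s_0 is reached through the word r_2 r_1 r_0 r_1 r_2. *)
Lemma type5Bp_of_type5Bd (v : 'I_5) :
  [/\ tnth type5Bp i0 v = tnth type5Bd i2 (tnth type5Bd i1 (tnth type5Bd i0
                            (tnth type5Bd i1 (tnth type5Bd i2 v)))),
      tnth type5Bp i1 v = tnth type5Bd i0 v &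
      tnth type5Bp i2 v = tnth type5Bd i1 v].
Proof.
split=> //; apply: ord_inj; elim/ord5_cases: v;
  by rewrite type5BpE !type5BdE !inordK.
Qed.

Theorem proposition7 (M : surface_map) :
  is_korbit 5 M -> is_korbit 5 (truncation M) ->
  has_type type5Bp M /\ has_type type5Bd (truncation M).
Proof.
move=> M5 T5; have [c [cL cadj]] := type5Bd_of_braid T5 (@truncation_braid M).
split; last exact: labelling_has_type cL cadj.
apply: (labelling_has_type (level_labelling i0 M5 cL)).
elim/ord3_cases=> x; have [E0 E1 E2] := type5Bp_of_type5Bd (c (x, i0)).
- by rewrite E0 -!cadj.
- by rewrite E1 -cadj.
- by rewrite E2 -cadj.
Qed.
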